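(* Let $C$ be a $d$-dimensional convex cube and let $f$ be a multivalued locally gross direction preserving map from $C$ to nonempty, compact subsets of $C$. Then there exists a point $x\in C$ such that $x\in f(x)$.
   Context: A fixed point of a multivalued map $f$ from $C\subset\mathbb{R}^d$ to nonempty subsets of $C$ is a point $x\in C$ with $x\in f(x)$. The multivalued map $f$ is called locally gross direction preserving if for every $x\in C$ which is not a fixed point there exists some $\delta>0$ such that $N_\delta(x)$ and $f(N_\delta(x))$ can be separated by some hyperplane of $\mathbb{R}^d$ (they lie on opposite sides of the hyperplane). Here $N_\delta(x)$ is the open ball of radius $\delta$ around $x$ in $\mathbb{R}^d$, and $f(N_\delta(x))=\bigcup_{y\in N_\delta(x)\cap C}f(y)$. The values $f(x)$ are not assumed to be convex. *)

(* Defs.v *)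
From mathcomp Require Import all_boot all_order all_algebra.
From mathcomp Require Import all_classical all_reals all_analysis.

Set Implicit Arguments.
Unset Strict Implicit.
Unset Printing Implicit Defensive.

Import Order.TTheory GRing.Theory Num.Theory.
Import numFieldNormedType.Exports.

Local Open Scope classical_set_scope.
Local Open Scope ring_scope.

Section Defs.
Context {R : realType} {d : nat}.

Definition dotr (u v : 'rV[R]_d) : R := \sum_(i < d) u 0 i * v 0 i.

(* The norm and the balls that the library puts on 'rV[R]_d are those of the
   sup norm, hence the explicit Euclidean versions. *)
Definition enorm (u : 'rV[R]_d) : R := Num.sqrt (dotr u u).

Definition eball (x : 'rV[R]_d) (r : R) : set 'rV[R]_d :=
  [set y | enorm (y - x) < r].

Definition unit_cube : set 'rV[R]_d :=
  [set t | forall i, 0 <= t 0 i <= 1].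

(* A full-dimensional solid cube with vertex p, edge length s, and edges along
   the rows of the orthogonal matrix Q. *)
Definition is_cube (C : set 'rV[R]_d) : Prop :=
  exists (p : 'rV[R]_d) (s : R) (Q : 'M[R]_d),
    [/\ 0 < s, Q *m Q^T = 1%:M &
        C = [set p + s *: (t *m Q) | t in unit_cube]].

(* A and B lie in opposite closed half-spaces of the hyperplane
   dotr a z = b. *)
Definition hyperplane_separated (A B : set 'rV[R]_d) : Prop :=
  exists (a : 'rV[R]_d) (b : R),
    [/\ a != 0,
        forall y, A y -> dotr a y <= b &
        forall z, B z -> b <= dotr a z].

(* Multivalued maps on C are total functions whose values outside C are
   never used. *)
Definition multimap_image (C : set 'rV[R]_d) (f : 'rV[R]_d -> set 'rV[R]_d)
    (A : set 'rV[R]_d) : set 'rV[R]_d :=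
  \bigcup_(y in A `&` C) f y.

Definition fixed_point (C : set 'rV[R]_d) (f : 'rV[R]_d -> set 'rV[R]_d)
    (x : 'rV[R]_d) : Prop :=
  C x /\ f x x.

Definition locally_gross_direction_preserving (C : set 'rV[R]_d)
    (f : 'rV[R]_d -> set 'rV[R]_d) : Prop :=
  forall x, C x -> ~ fixed_point C f x ->
    exists2 delta : R, 0 < delta &
      hyperplane_separated (eball x delta) (multimap_image C f (eball x delta)).

End Defs.

(* Main.v *)
Require Import Defs.
From mathcomp Require Import all_boot all_order all_algebra finmap.
From mathcomp Require Import all_classical all_reals all_analysis.

Set Implicit Arguments.
Unset Strict Implicit.
Unset Printing Implicit Defensive.

Import Order.TTheory GRing.Theory Num.Theory.
Import numFieldNormedType.Exports.

Local Open Scope classical_set_scope.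
Local Open Scope ring_scope.

(** Suppose that [f] has no fixed point.  The separating hyperplanes supply,
    near each [t], one vector [a] with [a . (z - u) > 0] for every [u] near [t]
    and every [z] in [f u].  Gluing these vectors with tent functions gives a
    continuous field [g] with [g u . (z - u) > 0] everywhere, whereas the
    variational inequality [g x . (w - x) <= 0] has a solution [x] on the cube.

    The variational inequality follows by compactness from a lemma of Kuhn: if
    0/1 labellings [lab i] of a grid are 0 on the face [q i = 0] and 1 on the
    opposite face, then some cell of the grid sees both values of every
    labelling.  Writing [d] for the coboundary of cubical cochains modulo 2,
    this holds because [d(lab 1) \cup .. \cup d(lab n)] sums to 1 over all
    cells: it is the coboundary of [lab 1 * (d(lab 2) \cup .. \cup d(lab n))],
    so Stokes' formula reduces the sum to the face where [lab 1 = 1]. *)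

(** * Cubical cochains modulo 2 on a grid, and Kuhn's lemma *)

Section CubicalCochains.
Variables n m : nat.
Local Notation point := {ffun 'I_n -> 'I_m.+2}.
Local Notation cochain := ({set 'I_n} -> point -> bool).
Implicit Types (A B : {set 'I_n}) (q u v : point) (d i l : 'I_n).
Implicit Types (F : cochain) (L : seq 'I_n).

Definition unit_step d : point := [ffun i => if i == d then 1 else 0].

(* A cochain on the torus: [F A q] is its value (mod 2) on the face with lowest
   corner [q] and directions [A].  Addition in ['I_m.+2] wraps around. *)
Definition cob F : cochain :=
  fun A q => \sum_(d in A) (F (A :\ d) (q + unit_step d) + F (A :\ d) q).

Lemma addbb_ring (b : bool) : (b + b = 0).
Proof. by case: b. Qed.

(** Each unordered pair of distinct directions is counted twice, and so cancels modulo 2. *)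
Lemma sum_offdiag_sym (G : 'I_n -> 'I_n -> bool) A :
  (forall c d, G c d = G d c) ->
  (\sum_(d in A) \sum_(c in A :\ d) G c d = 0).
Proof.
move=> symG.
have split_lt d : d \in A -> (\sum_(c in A :\ d) G c d =
    \sum_(c in A | (c < d)%N) G c d + \sum_(c in A | (d < c)%N) G c d).
  move=> dA; rewrite (bigID (fun c : 'I_n => (c < d)%N)) /=.
  congr (_ + _); apply: eq_bigl => c; rewrite !inE -(inj_eq val_inj) /=;
    by case: (ltngtP c d); rewrite ?andbT ?andbF.
rewrite (eq_bigr _ split_lt) big_split /=.
rewrite [X in (_ + X)](exchange_big_dep (mem A)) /=; last first.
  by move=> c d _ /andP[].
rewrite -big_split big1 //= => d dA.
rewrite [X in (_ + X)](eq_big (fun c => (c \in A) && (c < d)%N) (G^~ d)).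
- exact: addbb_ring.
- by move=> c; rewrite dA.
- by move=> c _; exact: symG.
Qed.

Lemma cobK F A q : cob (cob F) A q = 0.
Proof.
rewrite /cob.
pose G c d := (F (A :\ d :\ c) (q + unit_step d + unit_step c) +
  F (A :\ d :\ c) (q + unit_step d) + (F (A :\ d :\ c) (q + unit_step c) +
  F (A :\ d :\ c) q)).
transitivity (\sum_(d in A) \sum_(c in A :\ d) G c d).
  by apply: eq_bigr => d _; rewrite -big_split.
apply: sum_offdiag_sym => c d; rewrite /G.
have -> : A :\ d :\ c = A :\ c :\ d by rewrite !finset.setDDl finset.setUC.
rewrite (addrAC q) -!addrA; congr (_ + _); exact: addrCA.
Qed.

Variable lab : 'I_n -> point -> bool.

(* The cup product of the coboundaries of the [lab l], for [l] in [L], in a form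
   that makes it a coboundary; [cup_cons] gives the usual formula. *)
Fixpoint cup L : cochain :=
  if L is l :: L' then cob (fun B u => lab l u * cup L' B u)
  else fun _ _ => 1.

Lemma cob_cup L A q : cob (cup L) A q = 0.
Proof.
case: L => [|l L]; last exact: cobK.
by rewrite /cob big1.
Qed.

(** Leibniz rule: the two sides differ by [lab l q * cob (cup L) A q], which vanishes by
    [cob_cup]. *)
Lemma cup_cons l L A q :
  cup (l :: L) A q = (\sum_(d in A)
    (lab l (q + unit_step d) + lab l q) * cup L (A :\ d) (q + unit_step d)).
Proof.
rewrite /= /cob.
under eq_bigr do rewrite /=.
under [RHS]eq_bigr do rewrite mulrDl.
rewrite !big_split /=; congr (_ + _).
rewrite -!big_distrr /=; congr (_ * _).
have := cob_cup L A q; rewrite /cob big_split /=.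
by case: (\sum_(_ in _) _); case: (\sum_(_ in _) _).
Qed.

(** The vertices of the face with lowest corner [q] and directions [A]. *)
Definition cell A q : set point :=
  [set u | forall i, u i = q i \/ (i \in A /\ u i = q i + 1)].

Lemma cell_id A q : cell A q q.
Proof. by move=> i; left. Qed.

Lemma cell_step A q d u : d \in A -> cell (A :\ d) (q + unit_step d) u ->
  cell A q u.
Proof.
move=> dA qu i; have := qu i; rewrite !ffunE !inE.
case: (eqVneq i d) => [->|_] /=; first by case=> [->|[]//]; right.
by rewrite addr0.
Qed.

(** Some summand of [cup_cons] is nonzero: [lab k] changes along the edge from [q] in direction [d],
    and induction finds the changes of the other labels on the face at [q + unit_step d] with
    directions [A :\ d]. *)
Lemma cup_neq0 L A q : cup L A q -> forall l, l \in L ->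
  exists u v, [/\ cell A q u, cell A q v & lab l u != lab l v].
Proof.
elim: L A q => // k L IHL A q.
rewrite cup_cons => sum_neq0.
have [d dA] : exists2 d, d \in A &
    ((lab k (q + unit_step d) + lab k q) *
      cup L (A :\ d) (q + unit_step d)).
  apply: contrapT => none; move: sum_neq0; rewrite big1// => d dA.
  by apply/negbTE/negP => dn; apply: none; exists d.
move=> /andP[chg /IHL Lchg] l; rewrite inE => /predU1P[->|/Lchg].
- exists (q + unit_step d), q; split; last 1 first.
  + by move: chg; case: (lab _ _); case: (lab _ _).
  + exact: (cell_step dA (@cell_id _ _)).
  + exact: cell_id.
- move=> [u [v [qu qv uv]]]; exists u, v; split => //; exact: cell_step dA _.
Qed.

(* A box has side [m.+1]; its directions are [A], and its remaining coordinates
   are frozen at the top value [-1] of ['I_m.+2]. *)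
Definition box A q := [forall i, (i \in A) == (q i != -1)].

(** Shifting by [unit_step d] permutes the torus and carries [q d = -1] to [q d = 0]; modulo 2, all
    terms off these two faces cancel. *)
Lemma sum_telescope d (P : pred point) (H : point -> bool) :
  (forall q, P (q + unit_step d) = P q) ->
  (\sum_(q | P q && (q d != -1)) (H (q + unit_step d) + H q) =
   \sum_(q | P q && (q d == -1)) H q + \sum_(q | P q && (q d == 0)) H q).
Proof.
move=> Pd; rewrite big_split /=.
have -> : (\sum_(q | P q && (q d != -1)) H (q + unit_step d) =
           \sum_(q | P q && (q d != 0)) H q).
  rewrite [RHS](reindex_inj (addIr (unit_step d))) /=.
  by apply: eq_bigl => q; rewrite Pd !ffunE eqxx addr_eq0.
have := bigID (idx := 0) (op := +%R) (r := index_enum point)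
  (fun q : point => q d == -1) P H.
rewrite (bigID (fun q : point => q d == 0)) /=.
by do 4!case: (\sum_(_ | _) _).
Qed.

Hypothesis lab0 : forall i q, q i = 0 -> lab i q = false.
Hypothesis lab1 : forall i q, q i = -1 -> lab i q = true.

(** All vertices of the cell share the coordinate [q d], so [lab d] is constant there, against
    [cup_neq0]. *)
Lemma cup_face0 L A d q : d \in L -> d \notin A -> (q d == -1) || (q d == 0) ->
  cup L A q = 0.
Proof.
move=> dL dA qd; apply/negbTE/negP => /cup_neq0 /(_ d dL) [u [v [qu qv]]].
have [] := qu d; last by rewrite (negbTE dA) => -[].
have [] := qv d; last by rewrite (negbTE dA) => -[].
case/orP: qd => /eqP -> vd ud.
- by rewrite !lab1.
- by rewrite !lab0.
Qed.

Lemma sum_cup_box L : uniq L ->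
  (\sum_(q | box [set:: L] q) cup L [set:: L] q = 1).
Proof.
elim: L => [_|l L IHL /= /andP[lL uL]].
  (* Without directions the box is the single top corner, where the empty product is 1. *)
  rewrite (big_pred1 [ffun _ => -1]) // => q.
  apply/forallP/eqP => [q1|-> i]; last by rewrite ffunE eqxx inE.
  by apply/ffunP => i; have := q1 i; rewrite ffunE inE => /eqP/esym/negbFE/eqP.
rewrite -{}[RHS](IHL uL) /cob exchange_big /=.
have lS : l \in [set:: l :: L] by rewrite inE mem_head.
have -> : [set:: L] = [set:: l :: L] :\ l.
  by apply/setP => i; rewrite !inE; case: eqVneq => // ->; apply/negbTE.
set A := [set:: l :: L].
(* [P d] drops the condition on coordinate [d], which makes it invariant under steps in that
   direction. *)
pose P d q := [forall i, (i != d) ==> ((i \in A) == (q i != -1))].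
have Pstep d q : P d (q + unit_step d) = P d q.
  by apply: eq_forallb => i; rewrite !ffunE; case: eqVneq; rewrite ?addr0.
have boxP d q : d \in A -> box A q = P d q && (q d != -1).
  move=> dA; apply/forallP/andP => [bx|[/forallP Pq qd] i].
    split; last by have := bx d; rewrite dA => /eqP <-.
    by apply/forallP => i; apply/implyP.
  case: (eqVneq i d) (Pq i) => [-> _|//]; by rewrite dA qd.
rewrite (bigD1 l) //= (eq_bigl _ _ (fun q => boxP l q lS)).
rewrite (sum_telescope (fun q => lab l q * cup L (A :\ l) q) (Pstep _)) /=.
rewrite [X in (_ + X + _)]big1 ?addr0; last first.
  by move=> q /andP[_ /eqP /lab0 ->]; rewrite mul0r.
(* In a direction [d != l] both end faces contribute 0, because [d] is in [L] and [lab d] is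
   constant on each. *)
rewrite [X in (_ + X)]big1 ?addr0; last first.
  move=> d /andP[dA dl]; rewrite (eq_bigl _ _ (fun q => boxP d q dA)).
  rewrite (sum_telescope (fun q => lab l q * cup L (A :\ d) q) (Pstep _)) /=.
  have dL : d \in L by move: dA; rewrite !inE (negbTE dl).
  have dAd : d \notin A :\ d by rewrite !inE eqxx.
  by rewrite !big1 // => q /andP[_ qd]; rewrite (cup_face0 dL dAd) ?mulr0 ?qd
    ?orbT.
(* Only the face [q l = -1] is left; it is the box of [L], and [lab l = 1] on it. *)
apply: eq_big => [q|q /andP[_ /eqP /lab1 ->]]; last by rewrite mul1r.
apply/andP/forallP => [[/forallP Pq /eqP ql] i|bx].
  case: (eqVneq i l) (Pq i) => [->|il]; first by rewrite ql !inE !eqxx.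
  by rewrite !inE il.
split; last by have := bx l; rewrite !inE eqxx => /eqP/esym/negbFE.
by apply/forallP => i; apply/implyP => il; have := bx i; rewrite !inE il.
Qed.

Lemma kuhn_cell : exists q, (forall i, q i != -1) /\
  forall i, exists u v, [/\ cell [set: 'I_n] q u, cell [set: 'I_n] q v,
    lab i u = false & lab i v = true].
Proof.
have := sum_cup_box (enum_uniq 'I_n).
have -> : [set:: enum 'I_n] = [set: 'I_n]%SET.
  by apply/setP => i; rewrite !inE mem_enum.
move=> sum1.
have [q qbox qcup] : exists2 q, box [set: 'I_n]%SET q &
    cup (enum 'I_n) [set: 'I_n]%SET q.
  apply: contrapT => none; move: sum1; rewrite big1// => q qb.
  by apply/negbTE/negP => qn; apply: none; exists q.
exists q; split=> [i|i].
  by have /forallP/(_ i) := qbox; rewrite inE => /eqP <-.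
have [u [v [qu qv]]] := cup_neq0 qcup (mem_enum 'I_n i).
case Eu: (lab i u); case Ev: (lab i v) => // _.
- by exists v, u.
- by exists u, v.
Qed.

End CubicalCochains.

(** * A variational inequality on the unit cube, by compactness *)

Lemma compact_unit_cube (R : realType) (n : nat) :
  compact (@unit_cube R n).
Proof.
have -> : @unit_cube R n =
    [set v : 'rV[R]_n | forall i, `[0, 1]%classic (v ord0 i)].
  by apply/seteqP; split => v /= + i => /(_ i); rewrite in_itv.
apply: (@rV_compact R n (fun=> `[0, 1]%classic)) => i.
exact: segment_compact.
Qed.

Section VariationalInequality.
Variables (R : realType) (n : nat) (g : 'rV[R]_n -> 'rV[R]_n).
Hypothesis gC : forall i, continuous (fun x => g x 0 i).

Definition grid_point (m : nat) (q : {ffun 'I_n -> 'I_m.+2}) : 'rV[R]_n :=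
  \row_i ((q i)%:R / m.+1%:R).

Lemma val_ord_opp1 (m : nat) : (-1 : 'I_m.+2) = m.+1 :> nat.
Proof. by rewrite /= [(1 %% _)%N]modn_small // modn_small // subn1 /=. Qed.

Lemma grid_point_cube m (q : {ffun 'I_n -> 'I_m.+2}) :
  unit_cube (grid_point q).
Proof.
move=> i; rewrite mxE divr_ge0 //= ler_pdivrMr ?ltr0n// mul1r ler_nat.
by rewrite -ltnS ltn_ord.
Qed.

(** Inside the grid, label 1 means that [g] points downwards in direction [i]; on the two end faces
    the label is forced to the value that Kuhn's lemma demands. *)
Definition sign_label (m : nat) (i : 'I_n) (q : {ffun 'I_n -> 'I_m.+2}) :=
  (q i != 0) && ((q i == -1) || (g (grid_point q) 0 i < 0)).

Lemma grid_cell_dist m (q u : {ffun 'I_n -> 'I_m.+2}) i :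
  (forall j, q j != -1) -> cell [set: 'I_n] q u ->
  `|grid_point q 0 i - grid_point u 0 i| <= m.+1%:R^-1.
Proof.
move=> qN1 /(_ i); rewrite !mxE => -[->|[_ ->]].
  by rewrite subrr normr0 invr_ge0.
(* Below the top value, adding 1 does not wrap around. *)
have qi : (q i < m.+1)%N.
  rewrite ltn_neqAle -(ltnS (q i)) ltn_ord andbT.
  by have := qN1 i; rewrite -(inj_eq (@ord_inj _)) val_ord_opp1.
have -> : (q i + 1 : 'I_m.+2) = (q i).+1 :> nat.
  by rewrite /= modn_small /= ?addn1 ?modn_small // ltnS.
by rewrite -mulrBl -natr1 opprD addrA subrr sub0r mulN1r normrN gtr0_norm.
Qed.

(** [u] and [v] are vertices of Kuhn's cell with labels 0 and 1; the first alternative in each case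
    accounts for a forced label. *)
Lemma grid_witness m : exists q : {ffun 'I_n -> 'I_m.+2},
  forall i, exists u v : {ffun 'I_n -> 'I_m.+2},
  [/\ forall j, `|grid_point q 0 j - grid_point u 0 j| <= m.+1%:R^-1,
      forall j, `|grid_point q 0 j - grid_point v 0 j| <= m.+1%:R^-1,
      grid_point u 0 i = 0 \/ 0 <= g (grid_point u) 0 i &
      grid_point v 0 i = 1 \/ g (grid_point v) 0 i <= 0].
Proof.
have lab0 i (q : {ffun 'I_n -> 'I_m.+2}) : q i = 0 -> sign_label i q = false.
  by move=> qi; rewrite /sign_label qi eqxx.
have lab1 i (q : {ffun 'I_n -> 'I_m.+2}) : q i = -1 -> sign_label i q = true.
  by move=> qi; rewrite /sign_label qi eqxx oppr_eq0 oner_eq0.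
have [q [qN1 qlab]] := kuhn_cell lab0 lab1.
exists q => i; have [u [v [qu qv lu lv]]] := qlab i; exists u, v; split.
- by move=> j; exact: grid_cell_dist.
- by move=> j; exact: grid_cell_dist.
- move/negbT: lu; rewrite negb_and negbK negb_or -leNgt.
  by case/orP=> [/eqP ui|/andP[_]]; [left; rewrite mxE ui mul0r|right].
- case/andP: lv => _ /orP[/eqP vi|/ltW]; [left|by right].
  by rewrite mxE vi val_ord_opp1 divff.
Qed.

Lemma variational_inequality_cube : exists2 x, unit_cube x &
  forall w, unit_cube w -> dotr (g x) (w - x) <= 0.
Proof.
pose q m := projT1 (cid (grid_witness m)).
have [x [xcube xcl]] := @compact_unit_cube R n
  ((fun m => grid_point (q m)) @ \oo) _
  (filterE _ (fun m => grid_point_cube (q m))).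
(* A condition holding near the cluster point [x] holds at all grid points within one mesh width of
   some [grid_point (q m)]: take that point within [e / 2] of [x] and the mesh below [e / 2]. *)
have near_witness (P : set 'rV[R]_n) : (\forall y \near x, P y) ->
    exists m, forall u : {ffun 'I_n -> 'I_m.+2},
    (forall j, `|grid_point (q m) 0 j - grid_point u 0 j| <= m.+1%:R^-1) ->
    P (grid_point u).
  move=> /nbhs_ballP[e /= e0 eP].
  have e20 : 0 < e / 2 by rewrite divr_gt0.
  have [_ [[m me <-] [_ qx]]] : [set grid_point (q m) | m in
      [set m | m.+1%:R^-1 < e / 2]] `&` ball x (e / 2) !=set0.
    apply: xcl; last exact: nbhsx_ballx.
    have := near_infty_natSinv_lt (PosNum e20).
    by apply: filterS => m /= me; exists m.
  exists m => u qu; apply: eP; split => // i j; rewrite [e]splitr.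
  apply: ball_triangle (qx i j) _; rewrite ord1 /ball /=.
  exact: le_lt_trans (qu j) me.
(* Otherwise both strict inequalities hold near [x], hence at the witness [u] with label 0, which
   violates one of them. *)
have xlow i : x 0 i = 0 \/ 0 <= g x 0 i.
  apply: contrapT => /not_orP[/eqP xi0 /negP]; rewrite -ltNge => gi0.
  have xi_gt0 : 0 < x 0 i by rewrite lt_neqAle eq_sym xi0; case/andP: (xcube i).
  have [|m /= mP] := near_witness [set y : 'rV[R]_n | 0 < y 0 i /\ g y 0 i < 0].
    near=> y; split; near: y.
    - by apply: (cvgr_gt (x 0 i)) => //; exact: coord_continuous.
    - by apply: (cvgr_lt (g x 0 i)) => //; exact: gC.
  have [u [v [qu _ ulow _]]] := projT2 (cid (grid_witness m)) i.
  have [ui0] := mP u qu; case: ulow => [ui|].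
    by rewrite ui ltxx in ui0.
  by rewrite leNgt => /negbTE ->.
have xupp i : x 0 i = 1 \/ g x 0 i <= 0.
  apply: contrapT => /not_orP[/eqP xi1 /negP]; rewrite -ltNge => gi0.
  have xi_lt1 : x 0 i < 1 by rewrite lt_neqAle xi1; case/andP: (xcube i).
  have [|m /= mP] := near_witness [set y : 'rV[R]_n | y 0 i < 1 /\ 0 < g y 0 i].
    near=> y; split; near: y.
    - by apply: (cvgr_lt (x 0 i)) => //; exact: coord_continuous.
    - by apply: (cvgr_gt (g x 0 i)) => //; exact: gC.
  have [u [v [_ qv _ vupp]]] := projT2 (cid (grid_witness m)) i.
  have [vi1] := mP v qv; case: vupp => [vi|].
    by rewrite vi ltxx in vi1.
  by rewrite leNgt => /negbTE ->.
exists x => // w wcube; apply: sumr_le0 => i _; rewrite !mxE.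
have := xcube i; have := wcube i; move=> /andP[w0 w1] /andP[x0 x1].
(* At [x 0 i = 0] the increment is nonnegative and [g] nonpositive, at [x 0 i = 1] the reverse; in
   the remaining case [g] vanishes. *)
case: (xlow i) => [xi0|gi0]; case: (xupp i) => [xi1|gi1].
- by move: xi1; rewrite xi0 => /eqP; rewrite eq_sym oner_eq0.
- by apply: mulr_le0_ge0 => //; rewrite xi0 subr0.
- by apply: mulr_ge0_le0 => //; rewrite xi1 subr_le0.
- have -> : g x 0 i = 0 by apply/eqP; rewrite eq_le gi0 gi1.
  by rewrite mul0r.
Unshelve. all: by end_near. Qed.

End VariationalInequality.

(** * Algebra of the dot product *)

Section DotProduct.
Variables (R : realType) (n : nat).
Implicit Types (a u v : 'rV[R]_n) (Q : 'M[R]_n).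

Lemma dotrE u v : dotr u v = (u *m v^T) 0 0.
Proof. by rewrite !mxE; apply: eq_bigr => i _; rewrite mxE. Qed.

Lemma dotrDr a u v : dotr a (u + v) = dotr a u + dotr a v.
Proof. by rewrite -big_split; apply: eq_bigr => i _; rewrite mxE mulrDr. Qed.

Lemma dotrBr a u v : dotr a (u - v) = dotr a u - dotr a v.
Proof. by rewrite -sumrB; apply: eq_bigr => i _; rewrite !mxE mulrBr. Qed.

Lemma dotrZr a s u : dotr a (s *: u) = s * dotr a u.
Proof. by rewrite !dotrE linearZ /= -scalemxAr mxE. Qed.

Lemma dotrMr a u Q : dotr a (u *m Q) = dotr (a *m Q^T) u.
Proof. by rewrite !dotrE trmx_mul mulmxA. Qed.

Lemma dotr_gt0 a : a != 0 -> 0 < dotr a a.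
Proof.
move=> a0; rewrite lt_neqAle sumr_ge0 ?andbT; last first.
  by move=> i _; rewrite -expr2 sqr_ge0.
apply: contra a0; rewrite eq_sym psumr_eq0; last first.
  by move=> i _; rewrite -expr2 sqr_ge0.
move=> /allP aa; apply/eqP/rowP => i; rewrite mxE; apply/eqP.
by have := aa i (mem_index_enum i); rewrite mulf_eq0 orbb.
Qed.

Lemma dotr_suml (I : Type) (r : seq I) (c : I -> R) (a : I -> 'rV[R]_n) u :
  dotr (\sum_(t <- r) c t *: a t) u = \sum_(t <- r) c t * dotr (a t) u.
Proof.
rewrite dotrE mulmx_suml summxE; apply: eq_bigr => t _.
by rewrite -scalemxAl mxE dotrE.
Qed.

End DotProduct.

(** * Gluing local directions into a continuous field *)

Lemma continuous_sumr (R : realType) (T : topologicalType) (I : Type)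
    (r : seq I) (h : I -> T -> R) :
  (forall i, continuous (h i)) -> continuous (fun x => \sum_(i <- r) h i x).
Proof.
move=> hC; apply: continuous_big => [|i _]; last exact: hC.
exact: (@pseudometric_normed_Zmodule.add_continuous R R^o).
Qed.

Lemma continuous_tent (R : realType) (V : normedModType R) (t : V) (r : R) :
  continuous (fun u => Num.max (r - `|t - u|) 0 : R^o).
Proof.
move=> u; apply: (continuous_max (f := fun u => r - `|t - u|) (g := fun=> 0)).
  apply: cvgB; first exact: cvg_cst.
  by apply: cvg_norm; apply: cvgB; [exact: cvg_cst|exact: cvg_id].
exact: cvg_cst.
Qed.

(** For fixed [u] the admissible vectors [a] form a convex cone, so weighting the vectors of a
    finite subcover by tents supported on its balls keeps them admissible. *)
Lemma glued_field (R : realType) (n : nat) (K : set 'rV[R]_n)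
    (F : 'rV[R]_n -> 'rV[R]_n) : compact K ->
  (forall t, K t -> exists a, \forall u \near t, K u -> 0 < dotr a (F u - u)) ->
  exists g : 'rV[R]_n -> 'rV[R]_n, (forall i, continuous (fun u => g u 0 i)) /\
    forall u, K u -> 0 < dotr (g u) (F u - u).
Proof.
move=> cptK aK.
have /choice[ar arP] : forall t, exists ar : 'rV[R]_n * R, 0 < ar.2 /\
    (K t -> forall u, ball t ar.2 u -> K u -> 0 < dotr ar.1 (F u - u)).
  (* Points off [K] get a default pair with positive radius. *)
  move=> t; have [Kt|nKt] := pselect (K t); last by exists (0, 1).
  have [a /nbhs_ballP[r r0 ra]] := aK t Kt.
  by exists (a, r); split=> // _ u tu; exact: ra.
move: cptK; rewrite compact_cover => cptK.
have [t _||D DK KD] := cptK _ K (fun t => ball t (ar t).2).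
- exact: ball_open.
- by move=> t Kt; exists t => //; apply: ballxx; exact: (arP t).1.
pose w t u : R := Num.max ((ar t).2 - `|t - u|) 0.
have wC t : continuous (w t) by exact: continuous_tent.
exists (fun u => \sum_(t <- enum_fset D) w t u *: (ar t).1); split=> [i|u Ku].
- rewrite (_ : (fun u => _) = fun u =>
      \sum_(t <- enum_fset D) w t u * (ar t).1 0 i); last first.
    by apply/funext => u; rewrite summxE; apply: eq_bigr => t _; rewrite mxE.
  apply: (continuous_sumr (h := fun t u => w t u * (ar t).1 0 i)) => t u.
  apply: (@continuousM R _ (w t) (fun=> (ar t).1 0 i)); first exact: wC.
  exact: cst_continuous.
have w_ge0 t : 0 <= w t u by rewrite le_max lexx orbT.
have w_gt0 t : 0 < w t u = (ball t (ar t).2 u : Prop) :> Prop.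
  by rewrite -ball_normE /ball_ /= lt_max ltxx orbF subr_gt0.
have term_gt0 t : t \in D -> 0 < w t u -> 0 < w t u * dotr (ar t).1 (F u - u).
  move=> tD wt; rewrite mulr_gt0 //; apply: (arP t).2 => //.
    by apply/set_mem; exact: DK.
  by rewrite -w_gt0.
(* The ball around [t0] contains [u] and gives a strictly positive term; the other terms are
   positive or have weight 0. *)
have [t0 /= t0D ut0] := KD u Ku.
rewrite dotr_suml (bigD1_seq t0 t0D (fset_uniq D)) /=.
rewrite ltr_pwDl ?term_gt0 ?w_gt0 // big_seq_cond sumr_ge0 // => t /andP[tD _].
have [/term_gt0 wt|wt] := ltP 0 (w t u); first exact/ltW/wt.
have -> : w t u = 0 by apply/eqP; rewrite eq_le wt w_ge0.
by rewrite mul0r.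
Qed.

(** * Coordinates carrying the unit cube onto a given cube *)

Section CubeCoordinates.
Variables (R : realType) (n : nat) (p : 'rV[R]_n) (s : R) (Q : 'M[R]_n).
Hypotheses (s_gt0 : 0 < s) (Q_orth : Q *m Q^T = 1%:M).

Definition cube_chart (t : 'rV[R]_n) : 'rV[R]_n := p + s *: (t *m Q).

Lemma cube_chartB t u : cube_chart u - cube_chart t = s *: ((u - t) *m Q).
Proof. by rewrite /cube_chart opprD addrACA subrr add0r -scalerBr mulmxBl. Qed.

Lemma cube_chartD t a (h : R) :
  cube_chart (t + h *: (a *m Q^T)) = cube_chart t + (s * h) *: a.
Proof.
rewrite /cube_chart mulmxDl -scalemxAl -mulmxA (mulmx1C Q_orth) mulmx1.
by rewrite scalerDr scalerA addrA.
Qed.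

Lemma dotr_cube_chartB a t u :
  dotr a (cube_chart u) - dotr a (cube_chart t) =
  s * dotr (a *m Q^T) (u - t).
Proof. by rewrite -dotrBr cube_chartB dotrZr dotrMr. Qed.

(** Neighbourhoods refer to the sup norm, [eball] to the Euclidean one. As [Q] is orthogonal, the
    squared Euclidean distance is the function [N], continuous in the coordinates. *)
Lemma near_eball_chart t (r : R) : 0 < r ->
  \forall u \near t, eball (cube_chart t) r (cube_chart u).
Proof.
move=> r0; pose N (u : 'rV[R]_n) : R :=
  \sum_(j < n) (s * (u 0 j - t 0 j)) * (s * (u 0 j - t 0 j)).
have NE u :
    dotr (cube_chart u - cube_chart t) (cube_chart u - cube_chart t) = N u.
  rewrite cube_chartB scalemxAl dotrMr -mulmxA Q_orth mulmx1.
  by apply: eq_bigr => j _; rewrite !mxE.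
have sqC (T : topologicalType) (h : T -> R) c : continuous h ->
    continuous (fun x => (s * (h x - c)) * (s * (h x - c))).
  move=> hC x; have hx : s * (h y - c) @[y --> x] --> s * (h x - c).
    by apply: cvgMl_tmp; apply: cvgB; [exact: hC|exact: cvg_cst].
  exact: (cvgM hx hx).
have NC : continuous N.
  apply: (continuous_sumr
    (h := fun j (u : 'rV[R]_n) =>
      (s * (u 0 j - t 0 j)) * (s * (u 0 j - t 0 j)))).
  by move=> j; apply: sqC; exact: coord_continuous.
have Nt : N t < r ^+ 2.
  by rewrite /N big1 ?exprn_gt0 // => j _; rewrite subrr !mulr0.
near=> u; rewrite /eball /= /enorm NE.
rewrite -(gtr0_norm r0) -(sqrtr_sqr r) ltr_sqrt ?exprn_gt0 //.
by near: u; apply: (cvgr_lt (N t)) => //; exact: NC.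
Unshelve. all: by end_near. Qed.

End CubeCoordinates.

(** * Fixed points of locally gross direction preserving maps on a cube *)

Theorem theorem4p6 (R : realType) (d : nat) (C : set 'rV[R]_d)
    (f : 'rV[R]_d -> set 'rV[R]_d)
    (cubeC : is_cube C)
    (f_nonempty : forall x, C x -> f x !=set0)
    (f_compact : forall x, C x -> compact (f x))
    (f_sub : forall x, C x -> f x `<=` C)
    (f_lgdp : locally_gross_direction_preserving C f) :
  exists x, fixed_point C f x.
Proof.
have [p [s [Q [s_gt0 Q_orth CE]]]] := cubeC.
pose X := cube_chart p s Q.
have CX t : unit_cube t -> C (X t) by move=> tcube; rewrite CE; exists t.
(* [F] is a selection of [f] in cube coordinates, with default value 0 off the unit cube. *)
have /choice[F FP] : forall t, exists w,
    unit_cube t -> unit_cube w /\ f (X t) (X w).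
  move=> t; have [tcube|] := pselect (unit_cube t); last by exists 0.
  have [z fz] := f_nonempty _ (CX t tcube).
  have := f_sub _ (CX t tcube) z fz; rewrite CE => -[w wcube wz].
  by exists w => _; split=> //; rewrite /X /cube_chart wz.
apply: contrapT => nofix.
have [|g [gC gF]] := glued_field (F := F) (@compact_unit_cube R d).
  move=> t tcube.
  have [|delta delta0 [a [b [a0 ab fb]]]] := f_lgdp (X t) (CX t tcube).
    by move=> fixt; apply: nofix; exists (X t).
  exists (a *m Q^T).
  (* Joining keeps a whole neighbourhood of [u] inside the ball, which leaves room for the push
     along [a] below. *)
  have /near_join nearX := near_eball_chart p s Q_orth t delta0.
  near=> u => ucube.
  have uX : \forall v \near u, eball (X t) delta (X v) by near: u.
  (* Separation only gives [<= b]. Pushing [X u] slightly along [a] stays in the ball and raises the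
     dot product, so the inequality at [u] itself is strict. *)
  have au_lt_b : dotr a (X u) < b.
    have /nbhs_ballP[e /= e0 eX] := uX.
    (* This [h] makes the norm of [h *: c] smaller than [e]; the added 1 keeps the denominator
       positive. *)
    pose c := a *m Q^T; pose h := e / (`|c| + 1).
    have c1 : 0 < `|c| + 1 by rewrite ltr_wpDl.
    have h0 : 0 < h by rewrite divr_gt0.
    have /ab : eball (X t) delta (X (u + h *: c)).
      apply: eX; rewrite -ball_normE /ball_ /= opprD addrA subrr sub0r normrN.
      by rewrite normrZ gtr0_norm // mulrAC ltr_pdivrMr // ltr_pM2l // ltrDl.
    rewrite /X (cube_chartD p s Q_orth) dotrDr dotrZr; apply: lt_le_trans.
    by rewrite ltrDl !mulr_gt0 // dotr_gt0.
  have [wcube fw] := FP u ucube.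
  have bw : b <= dotr a (X (F u)).
    apply: fb; exists (X u) => //; split; last exact: CX.
    exact: nbhs_singleton uX.
  rewrite -(pmulr_rgt0 _ s_gt0) -(dotr_cube_chartB p).
  by rewrite subr_gt0 (lt_le_trans au_lt_b bw).
(* The variational inequality for [w = F x] contradicts the positivity of [g] at [x]. *)
have [x xcube xvi] := variational_inequality_cube gC.
have := gF x xcube; rewrite ltNge xvi //.
exact: (FP x xcube).1.
Unshelve. all: by end_near. Qed.
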